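(* Let $n\ge 1$ and let $\alpha\vDash n$ be a composition. Then $\mathfrak{S}^*_\alpha=F_\beta$ for some composition $\beta$ if and only if $\alpha$ is a top-aligned hook. In this case, $\mathfrak{S}^*_\alpha=F_\alpha$.
   Context: A composition $\alpha=(\alpha_1,\dots,\alpha_\ell)\vDash n$ is a finite list of positive integers with sum $n$. A top-aligned hook is a composition that is either $(1^n)$ or of the form $(1^{\ell-1},k)$ with $k\ge2$. In the variables $x_1,x_2,\dots$, the monomial quasisymmetric function is $M_\alpha=\sum_{i_1<\cdots<i_\ell}x_{i_1}^{\alpha_1}\cdots x_{i_\ell}^{\alpha_\ell}$. The fundamental quasisymmetric function is $F_\alpha=\sum_{\beta\preceq\alpha}M_\beta$, where $\beta\preceq\alpha$ means that the parts of $\alpha$ are obtained in order by adding adjacent parts of $\beta$. The diagram of $\alpha$ is the left-justified array of cells with $\alpha_i$ cells in row $i$, rows numbered from bottom to top. A semi-standard immaculate tableau of shape $\alpha$ and content $\beta$ is a filling of the diagram of $\alpha$ with positive integers, with $\beta_i$ entries equal to $i$ for each $i$, such that entries strictly increase from bottom to top in the first (leftmost) column and weakly increase from left to right in each row. Let $K_{\alpha,\beta}$ be the number of these. The dual immaculate function is $\mathfrak{S}^*_\alpha=\sum_{\beta\vDash n}K_{\alpha,\beta}M_\beta$. *)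

(* Defs.v *)
From HB Require Import structures.
From mathcomp Require Import all_boot all_order all_algebra finmap.
From mathcomp Require Import boolp classical_sets functions cardinality fsbigop.
From mathcomp.multinomials Require Import monalg.

Set Implicit Arguments.
Unset Strict Implicit.
Unset Printing Implicit Defensive.

Import GRing.Theory.
Local Open Scope classical_set_scope.
Local Open Scope ring_scope.

Definition is_composition (a : seq nat) : bool := 0%N \notin a.

Definition composition_of (n : nat) (a : seq nat) : bool :=
  is_composition a && (sumn a == n).

Definition top_aligned_hook (a : seq nat) : Prop :=
  (exists n : nat, a = nseq n 1%N) \/
  (exists l k : nat, (2 <= k)%N /\ a = rcons (nseq l 1%N) k).

(* b is cut into consecutive nonempty blocks whose sums are the parts of a. *)
Definition refines (b a : seq nat) : Prop :=
  exists bb : seq (seq nat),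
    [/\ [::] \notin bb, flatten bb = b & map sumn bb = a].

(* Formal power series with integer coefficients in countably many variables,
   given by their coefficients. The variables are indexed from 0: the index k
   stands for x_(k+1). *)
Definition powser : Type := {cmonom nat} -> int.

(* x_(i_1)^(a_1) * ... * x_(i_l)^(a_l), for sequences i and a of equal size *)
Definition monomial (i a : seq nat) : {cmonom nat} :=
  \big[mmul/mone]_(p <- zip i a) expcmn (ucm p.1) p.2.

(* A sum \sum_(x \in A) over a classical set is the sum of its nonzero terms,
   when these are finitely many. For a composition a this is the case in the
   three definitions below; e.g. in M, an i with monomial i a = m has all its
   entries in the finite support of m. *)

Definition M (a : seq nat) : powser := fun m =>
  \sum_(i \in [set i : seq nat | size i = size a /\ sorted ltn i])
    ((monomial i a == m)%:R : int).

Definition F (a : seq nat) : powser := fun m =>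
  \sum_(b \in [set b : seq nat | is_composition b /\ refines b a]) M b m.

(* A filling of the diagram of a is the list of its rows, from bottom to top,
   each read from left to right. *)
Definition immaculate_tableau (a b : seq nat) (T : seq (seq nat)) : Prop :=
  [/\ shape T = a,
      0%N \notin flatten T,
      forall k : nat, count_mem k.+1 (flatten T) = nth 0%N b k,
      sorted ltn [seq head 0%N r | r <- T]
    & all (sorted leq) T].

(* The set is finite: the shape is fixed and all entries lie in 1..size b. *)
Definition K (a b : seq nat) : nat :=
  #|` fset_set [set T : seq (seq nat) | immaculate_tableau a b T]|.

Definition dual_immaculate (a : seq nat) : powser := fun m =>
  \sum_(b \in [set b : seq nat | composition_of (sumn a) b]) (K a b)%:R * M b m.

(* Main.v *)
Require Import Defs.
From mathcomp Require Import all_boot all_algebra finmap zify.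
From mathcomp Require Import boolp classical_sets cardinality fsbigop.
From mathcomp.multinomials Require Import monalg.

(** A dual immaculate function and a fundamental quasisymmetric function are both
combinations of the M b with b a composition, and the coefficient of M b can be read off at the
monomial x_1^(b_1) ... x_l^(b_l), which occurs in no other M c with c a
composition. The coordinates are K a b on one side, and 1 or 0 on the other
according to whether b refines the given composition.

If a is a top-aligned hook, the first column followed by the top row lists all
the entries of a tableau in weakly increasing order (hook_tableau_word). Hence a
content b admits at most one tableau, and it admits one exactly when the entries
below the top row, and the first entry of that row, are strictly increasing,
that is, when b begins with as many parts 1 as there are rows below the top one.
This says that b refines a (refines_hook, hook_tableauP), so K a b is the
coordinate of F a and the two functions agree (dual_immaculate_hook).

If a is not a top-aligned hook, some row with at least two cells lies below
another row. Fill the diagram row by row with 1, 2, ..., n, and exchange the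
last entry of that row with the first entry of the next: this gives a second
standard tableau (swap_filling_tableau). So the coefficient of x_1 x_2 ... x_n is
at least 2 (K_non_hook), whereas it is at most 1 in every fundamental quasisymmetric
function (F_packed_monomial_le1). *)

Set Implicit Arguments.
Unset Strict Implicit.
Unset Printing Implicit Defensive.

(** * Compositions and refinement *)

Lemma is_composition_cons (x : nat) (a : seq nat) :
  is_composition (x :: a) = (0 < x) && is_composition a.
Proof. by rewrite /is_composition in_cons negb_or eq_sym -lt0n. Qed.

Lemma is_composition_nth (a : seq nat) (j : nat) :
  is_composition a -> j < size a -> 0 < nth 0 a j.
Proof.
by move=> a_comp lt_j; rewrite lt0n; apply: contra a_comp => /eqP <-; exact: mem_nth.
Qed.

Lemma refines_nil (b : seq nat) : refines b [::] <-> b = [::].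
Proof. by split=> [[[|c bb] [_ <- //]]|->]; exists [::]. Qed.

Lemma refines_cons (b a : seq nat) (x : nat) :
  refines b (x :: a) <->
  exists c b', [/\ c <> [::], b = c ++ b', sumn c = x & refines b' a].
Proof.
split=> [[[|c bb] [//= bb_nil <- [<- <-]]]|[c [b' [c_nil -> <- [bb [bb_nil <- <-]]]]]].
  exists c, (flatten bb); move: bb_nil; rewrite in_cons negb_or => /andP[c_nil bb_nil].
  split=> //; first by move=> c0; rewrite c0 in c_nil.
  by exists bb.
exists (c :: bb); split=> //; rewrite in_cons negb_or bb_nil andbT.
by apply/eqP => /esym.
Qed.

Lemma refines_sumn (b a : seq nat) : refines b a -> sumn b = sumn a.
Proof. by case=> bb [_ <- <-]; rewrite sumn_flatten. Qed.

(** Each part 1 of the hook is the sum of a nonempty block of positive integers,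
which must be the single part 1; the last block is unconstrained apart from its
sum. *)
Lemma refines_hook (b : seq nat) (l k : nat) :
    is_composition b -> 0 < k ->
  refines b (rcons (nseq l 1) k) <->
  exists c, b = nseq l 1 ++ c /\ sumn c = k.
Proof.
move=> + k_gt0; elim: l b => [|l IH] b b_comp /=.
  rewrite refines_cons; split.
    by case=> c [b' [_ -> sum_c /refines_nil ->]]; exists c; rewrite cats0.
  case=> c [-> sum_c]; exists c, [::]; split=> //; last exact/refines_nil.
  - by move=> c0; rewrite -sum_c c0 in k_gt0.
  - by rewrite cats0.
rewrite refines_cons; split.
  case=> [[|x c] [b' [_ b_eq /= sum_c ref_b']]] //.
  move: b_comp; rewrite b_eq cat_cons is_composition_cons => /andP[x_gt0 comp_cb'].
  have x1 : x = 1 by lia.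
  have c_nil : c = [::].
    case: c comp_cb' sum_c {b_eq} => // y c.
    by rewrite cat_cons is_composition_cons => /andP[y_gt0 _] /=; lia.
  subst x c.
  have [c' [-> sum_c']] := (IH b' comp_cb').1 ref_b'.
  by exists c'.
case=> c [b_eq sum_c]; move: b_comp.
rewrite b_eq is_composition_cons => /= comp_b'.
exists [:: 1], (nseq l 1 ++ c); split=> //.
by apply/(IH _ comp_b'); exists c.
Qed.

(** * Coefficients in the basis of monomial quasisymmetric functions *)

Lemma monomial_coef (i a : seq nat) (j : nat) :
  uniq i -> size i = size a -> monomial i a j = nth 0 a (index j i).
Proof.
rewrite /monomial; elim: i a => [|x i IH] [|y a] //=.
  by move=> _ _; rewrite big_nil cm1.
case/andP=> x_i i_uniq [size_ia]; rewrite big_cons /= cmM IH //.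
have -> k : expcmn (ucm x) k j = (x == j) * k.
  case: k => [|k]; first by rewrite muln0 cm1.
  rewrite /expcmn iteropS; elim: k => [|k IHk] /=; first by rewrite cmU muln1.
  by rewrite [LHS](cmM j (ucm x)) IHk cmU -mulnS.
case: eqP => [<-|_]; last by rewrite add0n.
by rewrite mul1n nth_default ?addn0 // -size_ia leqNgt index_mem.
Qed.

(** The support of the monomial recovers the increasing sequence of indices, and
its values on that support recover the exponents. The positivity of the parts
is essential: a zero exponent would hide its index. *)
Lemma monomial_inj (i i' a a' : seq nat) :
    sorted ltn i -> sorted ltn i' -> is_composition a -> is_composition a' ->
    size i = size a -> size i' = size a' ->
  monomial i a = monomial i' a' -> i = i' /\ a = a'.
Proof.
move=> i_sorted i'_sorted a_comp a'_comp size_ia size_ia' eq_mon.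
have uniq_sorted s : sorted ltn s -> uniq s.
  exact: (sorted_uniq ltn_trans ltnn).
have mem_pos s b j : sorted ltn s -> is_composition b -> size s = size b ->
    (j \in s) = (0 < monomial s b j).
  move=> s_sorted b_comp size_sb; rewrite monomial_coef ?uniq_sorted //.
  rewrite -index_mem size_sb; case: ltnP => [lt_j|le_j].
    by rewrite is_composition_nth.
  by rewrite nth_default.
have eq_i : i = i'.
  apply: (irr_sorted_eq ltn_trans ltnn) => // j.
  by rewrite (mem_pos i a) // (mem_pos i' a') // eq_mon.
split=> //; subst i'; apply: (@eq_from_nth _ 0); first by rewrite -size_ia.
move=> k lt_k; rewrite -size_ia in lt_k.
have := congr1 (fun m : {cmonom nat} => m (nth 0 i k)) eq_mon.
by rewrite /= !monomial_coef ?uniq_sorted // index_uniq ?uniq_sorted.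
Qed.

Section Coefficients.
Import GRing.Theory.
Local Open Scope ring_scope.
Local Open Scope classical_set_scope.

(** The monomial x_1^(c_1) ... x_l^(c_l). Among the M b with b a
composition it occurs in M c only, so its coefficient in a combination of them is
the coordinate on M c. *)
Definition packed_monomial (c : seq nat) : {cmonom nat} :=
  monomial (iota 0 (size c)) c.

Lemma M_packed_monomial (b c : seq nat) :
    is_composition b -> is_composition c ->
  M b (packed_monomial c) = (b == c)%:R.
Proof.
move=> b_comp c_comp; rewrite /M; have [->|neq_bc] := eqVneq b c.
  rewrite -(@fsbig_widen _ _ _ _ [set iota 0 (size c)]).
  - by rewrite fsbig_set1 eqxx.
  - by move=> _ ->; rewrite /= size_iota iota_ltn_sorted.
  move=> i /= [[size_i i_sorted] neq_i]; case: eqP => // eq_mon; case: neq_i.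
  by have [] := monomial_inj i_sorted (iota_ltn_sorted _ _) c_comp
    c_comp size_i (size_iota _ _) eq_mon.
apply: fsbig1 => i [size_i i_sorted]; case: eqP => // eq_mon.
case/eqP: neq_bc; by have [] := monomial_inj i_sorted
  (iota_ltn_sorted _ _) b_comp c_comp size_i (size_iota _ _) eq_mon.
Qed.

Lemma sum_M_packed_monomial (A : set (seq nat)) (k : seq nat -> int)
    (c : seq nat) :
    (forall b, A b -> is_composition b) -> is_composition c ->
  \sum_(b \in A) k b * M b (packed_monomial c) = if c \in A then k c else 0.
Proof.
move=> A_comp c_comp.
have termE b : A b -> k b * M b (packed_monomial c) = if b == c then k c else 0.
  move=> /A_comp b_comp; rewrite M_packed_monomial //.
  by case: eqP => [->|_]; rewrite ?mulr1 ?mulr0.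
have [/set_mem Ac|/negP nAc] := boolP (c \in A).
  rewrite -(@fsbig_widen _ _ _ _ [set c]).
  - by rewrite fsbig_set1 termE // eqxx.
  - by move=> _ ->.
  by move=> b /= [Ab /eqP neq_bc]; rewrite termE // (negPf neq_bc).
apply: fsbig1 => b Ab; rewrite termE //; case: eqP => // eq_bc.
by case: nAc; rewrite -eq_bc; apply: mem_set.
Qed.

Lemma dual_immaculate_packed_monomial (a c : seq nat) :
    composition_of (sumn a) c ->
  dual_immaculate a (packed_monomial c) = (K a c)%:R.
Proof.
move=> c_comp; rewrite /dual_immaculate sum_M_packed_monomial.
- by rewrite mem_set.
- by move=> b /andP[].
- by case/andP: c_comp.
Qed.

Lemma F_packed_monomial_le1 (a c : seq nat) :
  is_composition c -> F a (packed_monomial c) <= 1.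
Proof.
move=> c_comp; rewrite /F.
under eq_fsbigr do rewrite -[M _ _]mul1r.
by rewrite sum_M_packed_monomial //; [case: ifP | move=> b []].
Qed.

End Coefficients.

(** * Tableaux of hook shape *)

(** The weakly increasing word of content b, in the alphabet s, s+1, ... *)
Fixpoint content_word (s : nat) (b : seq nat) : seq nat :=
  if b is x :: b' then nseq x s ++ content_word s.+1 b' else [::].

Lemma content_word_ge (s : nat) (b : seq nat) (x : nat) :
  x \in content_word s b -> s <= x.
Proof.
elim: b s => [//|y b IH] s /=; rewrite mem_cat mem_nseq => /orP[/andP[_ /eqP->] //|/IH].
exact: ltnW.
Qed.

Lemma count_content_word (s k : nat) (b : seq nat) :
  count_mem (s + k) (content_word s b) = nth 0 b k.
Proof.
elim: b s k => [|y b IH] s k /=; first by rewrite nth_nil.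
rewrite count_cat count_nseq; case: k => [|k] /=.
  rewrite addn0 eqxx mul1n (count_memPn _) ?addn0 //.
  by apply/negP => /content_word_ge; rewrite ltnn.
by rewrite -addSnnS IH; case: eqP => //; lia.
Qed.

Lemma sorted_content_word (s : nat) (b : seq nat) : sorted leq (content_word s b).
Proof.
suff: forall t, t <= s -> path leq t (content_word s b).
  by move/(_ s (leqnn s))/path_sorted.
elim: b s => //= y b IH s t le_ts.
elim: y t le_ts => [|y IHy] t le_ts /=; first by apply: IH; lia.
by rewrite le_ts IHy.
Qed.

Lemma size_content_word (s : nat) (b : seq nat) : size (content_word s b) = sumn b.
Proof. by elim: b s => //= y b IH s; rewrite size_cat size_nseq IH. Qed.

Lemma content_word_ones (s l : nat) (c : seq nat) :
  content_word s (nseq l 1 ++ c) = iota s l ++ content_word (s + l) c.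
Proof.
by elim: l s => [|l IH] s /=; rewrite ?addn0 // IH addSnnS.
Qed.

(** A strict increase over the first l+1 letters forces each of the first l
letters to occur only once. *)
Lemma content_word_prefix (s l : nat) (b : seq nat) :
    is_composition b -> l < sumn b -> sorted ltn (take l.+1 (content_word s b)) ->
  exists c, b = nseq l 1 ++ c.
Proof.
elim: l s b => [|l IH] s [|x b] //=; first by exists (x :: b).
rewrite is_composition_cons; case: x => [//|[|x]] /=; last by rewrite ltnn.
move=> b_comp lt_l => /path_sorted inc.
by have [c ->] := IH _ _ b_comp lt_l inc; exists c.
Qed.

(** The content does not count the letter 0, hence the two hypotheses on it. *)
Lemma perm_content (w w' b : seq nat) : 0 \notin w -> 0 \notin w' ->
    (forall k, count_mem k.+1 w = nth 0 b k) ->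
    (forall k, count_mem k.+1 w' = nth 0 b k) ->
  perm_eq w w'.
Proof.
move=> w0 w'0 cw cw'; apply/allP => x _ /=; apply/eqP; case: x => [|k].
  by rewrite !(count_memPn _).
by rewrite cw cw'.
Qed.

Lemma shape_hook (T : seq (seq nat)) (l k : nat) :
    shape T = rcons (nseq l 1) k ->
  exists u r, [/\ T = rcons [seq [:: x] | x <- u] r, size u = l & size r = k].
Proof.
elim: l T => [|l IH] [|r T] //=; first by case: T => // -[size_r]; exists [::], r.
case: r => [|x [|]] // [] /IH[u [r [-> <- <-]]].
by exists (x :: u), r.
Qed.

Lemma flatten_singletons (u r : seq nat) :
  flatten (rcons [seq [:: x] | x <- u] r) = u ++ r.
Proof. by rewrite flatten_rcons; congr (_ ++ _); exact: flatten_seq1. Qed.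

Lemma heads_hook (u r : seq nat) :
  [seq head 0 r' | r' <- rcons [seq [:: x] | x <- u] r] = rcons u (head 0 r).
Proof. by rewrite map_rcons -map_comp map_id. Qed.

(** Read from bottom to top, a tableau of hook shape increases strictly along the
first column and then weakly along the top row. So its reading word is weakly
increasing, hence determined by the content, and the shape of the hook only
asks for strict increases among the first l+1 letters. *)
Lemma hook_tableau_word (b : seq nat) (T : seq (seq nat)) (l k : nat) :
    0 < k -> immaculate_tableau (rcons (nseq l 1) k) b T ->
  flatten T = content_word 1 b /\ sorted ltn (take l.+1 (flatten T)).
Proof.
move=> k_gt0 [/shape_hook[u [r [-> size_u size_r]]]].
rewrite flatten_singletons heads_hook all_rcons => ur0 cnt inc /andP[r_sorted _].
case: r size_r ur0 cnt inc r_sorted => [|x r] size_r; first by rewrite -size_r in k_gt0.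
rewrite /= => ur0 cnt inc r_sorted; rewrite -cat_rcons take_size_cat ?size_rcons ?size_u //.
split=> //.
apply: (sorted_eq leq_trans anti_leq).
- have := sub_sorted (fun m n => @ltnW m n) inc.
  rewrite cat_rcons; case: u {size_u ur0 cnt inc} => //= y u.
  by rewrite rcons_path cat_path /= => /andP[-> ->].
- exact: sorted_content_word.
- apply: (@perm_content _ _ b) => //; first by rewrite cat_rcons.
  + by apply/negP => /content_word_ge.
  + by rewrite cat_rcons.
  + by move=> j; rewrite -add1n count_content_word.
Qed.

(** The unique candidate is the increasing word of content b. It is a tableau
exactly when b begins with l parts 1, that is, when b refines the hook. *)
Lemma hook_tableauP (b : seq nat) (l k : nat) :
    0 < k -> composition_of (sumn (rcons (nseq l 1) k)) b ->
  (exists T, immaculate_tableau (rcons (nseq l 1) k) b T) <->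
  refines b (rcons (nseq l 1) k).
Proof.
move=> k_gt0 /andP[b_comp /eqP]; rewrite sumn_rcons sumn_nseq mul1n => sum_b.
rewrite refines_hook //; split=> [[T T_tab]|[c [b_eq sum_c]]].
  have [wordE inc] := hook_tableau_word k_gt0 T_tab.
  rewrite wordE in inc.
  have [|c b_eq] := content_word_prefix b_comp _ inc; first by lia.
  exists c; split=> //; move: sum_b.
  by rewrite b_eq sumn_cat sumn_nseq mul1n => /addnI.
case: c b_eq sum_c => [|y c] b_eq sum_c; first by rewrite -sum_c in k_gt0.
have y_gt0 : 0 < y.
  move: b_comp; rewrite b_eq /is_composition mem_cat in_cons.
  by case: y {b_eq sum_c}; rewrite ?orbT.
set r := content_word l.+1 (y :: c).
have r_head : head 0 r = l.+1 by rewrite /r; case: y y_gt0 {b_eq sum_c r}.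
exists (rcons [seq [:: x] | x <- iota 1 l] r).
have wordE : flatten (rcons [seq [:: x] | x <- iota 1 l] r) = content_word 1 b.
  by rewrite flatten_singletons b_eq content_word_ones add1n.
split.
- rewrite /shape map_rcons size_content_word sum_c -map_comp; congr rcons.
  by rewrite -[in RHS](size_iota 1 l); elim: (iota 1 l) => //= _ w ->.
- by rewrite wordE; apply/negP => /content_word_ge.
- by move=> j; rewrite wordE -add1n count_content_word.
- rewrite heads_hook r_head -cats1 -[[:: _]]/(iota (1 + l) 1) -iotaD.
  exact: iota_ltn_sorted.
- by rewrite all_rcons sorted_content_word /=; apply/allP => _ /mapP[x _ ->].
Qed.

Lemma immaculate_tableau_unique_hook (b : seq nat) (T T' : seq (seq nat)) (l k : nat) :
    0 < k ->
    immaculate_tableau (rcons (nseq l 1) k) b T ->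
    immaculate_tableau (rcons (nseq l 1) k) b T' -> T = T'.
Proof.
move=> k_gt0 T_tab T'_tab; rewrite -[T]flattenK -[T']flattenK.
case: (T_tab) (T'_tab) => -> _ _ _ _ [-> _ _ _ _].
have [-> _] := hook_tableau_word k_gt0 T_tab.
by have [-> _] := hook_tableau_word k_gt0 T'_tab.
Qed.

Section Hooks.
Local Open Scope ring_scope.
Local Open Scope classical_set_scope.
Import GRing.Theory.

Lemma K_hook (b : seq nat) (l k : nat) :
    (0 < k)%N -> composition_of (sumn (rcons (nseq l 1%N) k)) b ->
  K (rcons (nseq l 1%N) k) b = `[< refines b (rcons (nseq l 1%N) k) >].
Proof.
move=> k_gt0 b_comp; rewrite /K.
have [/(hook_tableauP k_gt0 b_comp)[T T_tab]|no_ref] := asboolP.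
  rewrite (_ : mkset _ = [set T]) ?fset_set1 ?cardfs1 //.
  apply/seteqP; split=> T' /= => [T'_tab|-> //].
  exact: immaculate_tableau_unique_hook T'_tab T_tab.
rewrite (_ : mkset _ = set0) ?fset_set0 //.
apply/seteqP; split=> T //= T_tab; apply: no_ref.
by apply/(hook_tableauP k_gt0 b_comp); exists T.
Qed.

(** Both sides are sums of M b with coefficients 0 or 1. Refinement preserves the
sum of the parts, so restricting the left sum to the refinements of the hook
gives the right sum. *)
Lemma dual_immaculate_hook (l k : nat) : (0 < k)%N ->
  dual_immaculate (rcons (nseq l 1%N) k) = F (rcons (nseq l 1%N) k).
Proof.
move=> k_gt0; apply/funext => m; rewrite /dual_immaculate /F.
set a := rcons _ _; pose A := [set b | composition_of (sumn a) b].
transitivity (\sum_(b \in A)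
    if b \in [set b | is_composition b /\ refines b a] then M b m else 0).
  apply: eq_fsbigr => b /set_mem b_comp; rewrite K_hook // -/a.
  case: asboolP => ref_b; first by rewrite mem_set ?mul1r //; case/andP: b_comp.
  by rewrite mul0r memNset // => -[].
rewrite -fsbig_mkcondr; congr (\sum_(b \in _) _).
apply/seteqP; split=> b /= => [[] //|[b_comp ref_b]]; split=> //.
by rewrite /A /= /composition_of b_comp (refines_sumn ref_b) eqxx.
Qed.

End Hooks.

(** * Other shapes *)

(** Tableaux of one shape and one content have reading words that are
permutations of one another, and the shape and the reading word determine the
tableau. Finiteness is needed because fset_set of an infinite set is empty,
which would make K vanish. *)
Lemma finite_immaculate_tableaux (a b : seq nat) :
  finite_set (mkset (immaculate_tableau a b)).
Proof.
have [[T0 [_ T0_pos T0_cont _ _]]|none] := pselect (exists T, immaculate_tableau a b T).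
  apply: (@sub_finite_set _ _
    [set` [seq reshape a w | w <- permutations (flatten T0)]]%classic) => //.
  move=> T /= [T_shape T_pos T_cont _ _]; apply/mapP; exists (flatten T).
    by rewrite mem_permutations; exact: perm_content T_pos T0_pos T_cont T0_cont.
  by rewrite -T_shape flattenK.
rewrite (_ : mkset _ = set0) //; apply/seteqP; split=> T //= T_tab.
by apply: none; exists T.
Qed.

Lemma K_ge2 (a b : seq nat) (T T' : seq (seq nat)) :
    T != T' -> immaculate_tableau a b T -> immaculate_tableau a b T' ->
  2 <= K a b.
Proof.
move=> neq_T T_tab T'_tab.
have <- : #|` [fset T; T']%fset| = 2 by rewrite cardfs2 neq_T.
apply: fsubset_leq_card; apply/fsubsetP => T1.
rewrite in_fset_set; last exact: finite_immaculate_tableaux.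
by rewrite !inE => /orP[] /eqP ->.
Qed.

(** The shape p, x+2, y+1, q, filled row by row with consecutive integers, except
that u ends the row of length x+2 and v begins the next one. With
N = sumn p + x + 2, the choice u = N and v = N+1 is the plain row by row filling,
and u = N+1 and v = N exchanges two entries of it. *)
Definition swap_filling (p q : seq nat) (x y u v : nat) : seq (seq nat) :=
  let m := sumn p in
  reshape p (iota 1 m) ++
  [:: m.+1 :: rcons (iota m.+2 x) u; v :: iota (m + x + 4) y] ++
  reshape q (iota (m + x + y + 4) (sumn q)).

Lemma heads_subseq (T : seq (seq nat)) :
  [::] \notin T -> subseq [seq head 0 r | r <- T] (flatten T).
Proof.
elim: T => //= -[//|x r] T IH; rewrite in_cons /= eqxx => T_nil.
exact: subseq_trans (IH T_nil) (suffix_subseq _ _).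
Qed.

Lemma reshape_heads_subseq (p w : seq nat) : is_composition p -> size w = sumn p ->
  subseq [seq head 0 r | r <- reshape p w] w.
Proof.
move=> p_comp size_w.
have {2}<- : flatten (reshape p w) = w by apply: reshapeKr; rewrite size_w.
apply: heads_subseq; apply: contra p_comp => nil_in.
by rewrite -(@reshapeKl _ p w) ?size_w //; apply/mapP; exists [::].
Qed.

Lemma reshape_sorted (p w : seq nat) : sorted leq w -> all (sorted leq) (reshape p w).
Proof.
elim: p w => //= n p IH w w_sorted; rewrite take_sorted //=.
by apply: IH; exact: drop_sorted.
Qed.

(** As the row that ends with u has at least two cells, u is not in the first
column; so even after the exchange the first column is a subsequence of
1, 2, ..., n, and is strictly increasing. The rows stay sorted because N and N+1
are consecutive. *)
Lemma swap_filling_tableau (p q : seq nat) (x y u v : nat) :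
    let N := sumn p + x + 2 in
    is_composition p -> is_composition q ->
    (u = N /\ v = N.+1) \/ (u = N.+1 /\ v = N) ->
  immaculate_tableau (p ++ [:: x.+2, y.+1 & q])
    (nseq (sumn (p ++ [:: x.+2, y.+1 & q])) 1) (swap_filling p q x y u v).
Proof.
move=> N p_comp q_comp uv; set m := sumn p; set n := sumn _.
have nE : n = m + (x + y.+3 + sumn q) by rewrite /n sumn_cat /=; lia.
have reshapeE c s : flatten (reshape c (iota s (sumn c))) = iota s (sumn c).
  by apply: reshapeKr; rewrite size_iota.
(* The entries N and N.+1, which end one row and begin the next, are kept apart
   so that the two cases differ by one transposition. *)
have iotaE : iota 1 n = iota 1 m ++ (m.+1 :: iota m.+2 x ++ [:: N; N.+1] ++ iota (m + x + 4) y)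
    ++ iota (m + x + y + 4) (sumn q).
  rewrite nE iotaD; congr (_ ++ _); rewrite add1n iotaD.
  congr (_ ++ _); last by congr iota; lia.
  rewrite -[y.+3]/(1 + (2 + y)) addnCA add1n /= iotaD; congr (_ :: _ ++ _).
  by rewrite /N /= -/m; congr [:: _, _ & iota _ _]; lia.
have flattenE : perm_eq (flatten (swap_filling p q x y u v)) (iota 1 n).
  rewrite iotaE /swap_filling !flatten_cat /= !reshapeE -/m perm_cat2l.
  rewrite cats0 -cats1 /= perm_cons -!catA perm_cat2l /= -!cat_cons perm_cat2r.
  by case: uv => -[-> ->] //; rewrite (perm_catCA [:: N.+1] [:: N]).
split.
- rewrite /swap_filling /shape !map_cat /= -/(shape _) -/(shape _).
  by rewrite !reshapeKl ?size_iota // size_rcons !size_iota.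
- by rewrite (perm_mem flattenE) mem_iota.
- move=> k; rewrite (permP flattenE) count_uniq_mem ?iota_uniq // mem_iota.
  by rewrite nth_nseq add1n !ltnS; case: ltnP.
- apply: (subseq_sorted ltn_trans _ (iota_ltn_sorted 1 n)).
  rewrite iotaE /swap_filling !map_cat /=.
  apply: cat_subseq; first by apply: reshape_heads_subseq; rewrite ?size_iota.
  rewrite -[m.+1 :: v :: _]/([:: m.+1; v] ++ _).
  rewrite -cat_cons; apply: cat_subseq; last by apply: reshape_heads_subseq; rewrite ?size_iota.
  rewrite /= eqxx sub1seq mem_cat !in_cons.
  by case: uv => -[_ ->]; rewrite eqxx !orbT.
rewrite /swap_filling !all_cat !reshape_sorted ?iota_sorted //= !andbT.
rewrite /N -/m in uv *; apply/andP; split.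
  rewrite rcons_path; apply/andP; split; first exact: (iota_sorted m.+1 x.+1).
  have : last m.+1 (iota m.+2 x) \in iota m.+1 x.+1 by exact: mem_last.
  by rewrite mem_iota; lia.
rewrite (path_sortedE leq_trans) iota_sorted andbT; apply/allP => z.
by rewrite mem_iota; lia.
Qed.

(** A composition all of whose parts but the last are 1 is a top-aligned hook, so
in any other one some part larger than 1 is followed by another part. *)
Lemma non_hook_split (a : seq nat) :
    is_composition a -> a != [::] -> ~ top_aligned_hook a ->
  exists p q x y, a = p ++ [:: x.+2, y.+1 & q].
Proof.
case/lastP: a => // s k a_comp _ not_hook.
have k_gt0 : 0 < k.
  by rewrite lt0n; apply: contra a_comp => /eqP ->; rewrite mem_rcons mem_head.
have [s1|/allPn[z z_s z_neq1]] := boolP (all (pred1 1) s).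
  case: not_hook; move/all_pred1P: s1 => ->.
  have [k1|k_neq1] := eqVneq k 1.
    by left; exists (size s).+1; rewrite k1 -cats1 -[[:: 1]]/(nseq 1 1) -nseqD addn1.
  by right; exists (size s), k; split=> //; lia.
have a_pos t : t \in rcons s k -> 0 < t.
  by move=> t_in; rewrite lt0n; apply: contra a_comp => /eqP <-.
case/splitPr: z_s a_pos {a_comp not_hook} => p r a_pos.
have z_gt0 : 0 < z by apply: a_pos; rewrite mem_rcons inE mem_cat mem_head !orbT.
have : rcons r k != [::] by case: (r).
case r_eq : (rcons r k) => [//|y q] _.
have y_gt0 : 0 < y.
  by apply: a_pos; rewrite rcons_cat rcons_cons r_eq mem_cat !in_cons eqxx !orbT.
exists p, q, z.-2, y.-1; rewrite rcons_cat rcons_cons r_eq.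
by congr (_ ++ _ :: _ :: _); simpl in z_neq1; lia.
Qed.

Lemma K_non_hook (a : seq nat) :
    is_composition a -> a != [::] -> ~ top_aligned_hook a ->
  2 <= K a (nseq (sumn a) 1).
Proof.
move=> a_comp a_nil not_hook.
have [p [q [x [y a_eq]]]] := non_hook_split a_comp a_nil not_hook.
have [p_comp q_comp] : is_composition p /\ is_composition q.
  by move: a_comp; rewrite a_eq /is_composition mem_cat !in_cons !negb_or => /and4P[].
pose N := sumn p + x + 2; rewrite a_eq.
apply: (@K_ge2 _ _ (swap_filling p q x y N N.+1) (swap_filling p q x y N.+1 N)).
- rewrite /swap_filling eqseq_cat // eqxx /= !eqseq_cons.
  by rewrite eqseq_rcons /=; lia.
- by apply: swap_filling_tableau => //; left.
- by apply: swap_filling_tableau => //; right.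
Qed.

Theorem proposition5p4 (n : nat) (alpha : seq nat) :
  (1 <= n)%N -> composition_of n alpha ->
  ((exists beta : seq nat,
      is_composition beta /\ dual_immaculate alpha = F beta)
   <-> top_aligned_hook alpha)
  /\ (top_aligned_hook alpha -> dual_immaculate alpha = F alpha).
Proof.
move=> n_gt0 /andP[alpha_comp /eqP sum_alpha].
have alpha_nil : alpha != [::] by apply: contraTneq n_gt0 => nil; rewrite -sum_alpha nil.
have hook_eq : top_aligned_hook alpha -> dual_immaculate alpha = F alpha.
  case=> [[l alpha_eq]|[l [k [k_ge2 ->]]]]; last by apply: dual_immaculate_hook; lia.
  (* The shape (1^(l+1)) is the hook whose last part is 1. *)
  case: l alpha_eq alpha_nil => [-> //|l] -> _.
  by rewrite -addn1 nseqD cats1; exact: dual_immaculate_hook.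
split=> //; split=> [[beta [_ eq_F]]|hook]; last first.
  by exists alpha; split=> //; exact: hook_eq.
apply/notP => not_hook.
have ones_comp : is_composition (nseq (sumn alpha) 1).
  by rewrite /is_composition mem_nseq andbF.
have := F_packed_monomial_le1 beta ones_comp.
rewrite -eq_F dual_immaculate_packed_monomial.
  have := K_non_hook alpha_comp alpha_nil not_hook.
  by lia.
by rewrite /composition_of ones_comp sumn_nseq mul1n eqxx.
Qed.
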